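(* For all integers $n\ge 0$, $$K_n(x)=n!\sum_{k=0}^{n}\frac{J_k(x)}{k!}.$$
   Context: All identities are between polynomials in an indeterminate $x$ with real coefficients. For $n\ge 0$, $K_n(x)=n!\sum_{k=0}^{n}\binom{n+k+1}{n-k}\frac{x^k}{k!}$. The polynomials $J_n(x)$ are defined by $J_0(x)=1$ and $J_n(x)=K_n(x)-nK_{n-1}(x)$ for $n\ge 1$; equivalently $J_n(x)=n!\sum_{k=0}^{n}\binom{n+k}{n-k}\frac{x^k}{k!}$ for $n\ge 0$. *)

(* Defs.v *)
From mathcomp Require Import all_boot all_order all_algebra.
From mathcomp Require Import reals.

Set Implicit Arguments.
Unset Strict Implicit.
Unset Printing Implicit Defensive.

Import GRing.Theory.
Local Open Scope ring_scope.

Definition K (R : realType) (n : nat) : {poly R} :=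
  n`!%:R *: \sum_(k < n.+1) ('C(n + k + 1, n - k)%:R / k`!%:R) *: 'X^k.

Definition J (R : realType) (n : nat) : {poly R} :=
  if n is m.+1 then K R m.+1 - m.+1%:R *: K R m else 1.

Arguments K R n : clear implicits.
Arguments J R n : clear implicits.

(* Main.v *)
Require Import Defs.
From mathcomp Require Import all_boot all_order all_algebra.
From mathcomp Require Import reals.

Import GRing.Theory Num.Theory.
Local Open Scope ring_scope.

(** Dividing the recurrence [K_n = J_n + n K_(n-1)] by [n!] gives
    [K_n / n! - K_(n-1) / (n-1)! = J_n / n!], so the sum of the [J_k / k!]
    telescopes, starting from [K_0 = J_0 = 1].  The proof is the corresponding
    induction on [n], with denominators cleared. *)

Lemma K0 (R : realType) : K R 0 = 1.
Proof. by rewrite /K big_ord1 /= bin0 divr1 expr0 !scale1r. Qed.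

Lemma K_recurrence (R : realType) (n : nat) :
  K R n.+1 = n.+1%:R *: K R n + J R n.+1.
Proof. by rewrite /= addrC subrK. Qed.

Theorem theorem3p5 (R : realType) (n : nat) :
  K R n = n`!%:R *: \sum_(k < n.+1) (k`!%:R)^-1 *: J R k.
Proof.
elim: n => [|n IHn]; first by rewrite K0 big_ord1 /= invr1 !scale1r.
have fact_neq0 : n.+1`!%:R != 0 :> R by rewrite pnatr_eq0 -lt0n fact_gt0.
rewrite big_ord_recr scalerDr scalerA (divff fact_neq0) scale1r.
by rewrite K_recurrence IHn scalerA -natrM -factS.
Qed.
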